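(* Let $\varphi:I\to\mathbb{R}$ be a differentiable function on an open interval $I$, let $\phi\in\mathcal{D}_{\varphi}$ with domain $I_\phi\subset I$, and let $\rho=\rho_{\varphi}(\phi):I_\phi\to\mathbb{R}^3$ be the corresponding intrinsic representation curve, where $\int\varphi\phi'\sin\phi\,ds$ denotes the fixed antiderivative used in the definition of $\rho_\varphi(\phi)$. Then, at every $s\in I_\phi$: 1. The curvature of $\rho$ is $$\kappa_{\rho}=\frac{\phi'\sin\phi}{\sqrt{\sin^2\phi-\left(\int\varphi\phi'\sin\phi\,ds\right)^2}}.$$ 2. The torsion of $\rho$ is $$\tau_{\rho}=\frac{\varphi\,\phi'\sin\phi}{\sqrt{\sin^2\phi-\left(\int\varphi\phi'\sin\phi\,ds\right)^2}}.$$ 3. The intrinsic fraction function of $\rho$ is $\dfrac{\tau_\rho}{\kappa_\rho}(s)=\varphi(s)$ for all $s\in I_\phi$. 4. The geodesic curvature in the unit sphere $S^2$ of the curve traced by the principal normal vector $\mathbf{n}$ of $\rho$ is $$\sigma_{\rho}=\frac{\varphi'\sqrt{\sin^2\phi-\left(\int\varphi\phi'\sin\phi\,ds\right)^2}}{(1+\varphi^2)^{3/2}\,\phi'\sin\phi}.$$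
   Context: ''Differentiable'' means $C^\infty$. For a differentiable $\varphi:I\to\mathbb{R}$ on an open interval $I$, $\mathcal{D}_{\varphi}$ is the set of differentiable functions $\phi:I_\phi\to\mathbb{R}$, with $I_\phi\subset I$ an open interval, such that on $I_\phi$ $$1>\cos^2\phi+\left(\int\varphi(\cos\phi)'\,ds\right)^2\quad\text{and}\quad(\cos\phi)'<0.$$ Here $\int f\,ds$ denotes an antiderivative of $f$. For $\int\varphi(\cos\phi)'ds=-\int\varphi\phi'\sin\phi\,ds$, one antiderivative satisfying the inequality is fixed, and the same one is used everywhere it occurs. Put $F=\int\varphi\phi'\sin\phi\,ds$, so $F'=\varphi\phi'\sin\phi$ and $F^2<\sin^2\phi$ on $I_\phi$. For $\phi\in\mathcal{D}_\varphi$ the intrinsic representation curve is $$\rho_\varphi(\phi)(s)=\left(\int\sin\phi\cos\theta\,ds,\ \int\sin\phi\sin\theta\,ds,\ \int\cos\phi\,ds\right),\qquad \theta=\int\frac{\phi'\csc\phi\;F}{\sqrt{\sin^2\phi-F^2}}\,ds,$$ for any choice of the remaining antiderivatives. It is parametrized by arc length $s$. For a unit-speed curve with Frenet frame $\mathbf{t},\mathbf{n},\mathbf{b}$, curvature $\kappa>0$ and torsion $\tau$ are given by $\mathbf{t}'=\kappa\mathbf{n}$, $\mathbf{n}'=-\kappa\mathbf{t}+\tau\mathbf{b}$, $\mathbf{b}'=-\tau\mathbf{n}$, with $\mathbf{b}=\mathbf{t}\wedge\mathbf{n}$. The intrinsic fraction function of the curve is $s\mapsto\tau(s)/\kappa(s)$.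 The geodesic curvature in item 4 is the signed geodesic curvature of the spherical curve $s\mapsto\mathbf{n}(s)\in S^2$, i.e. $\det(\mathbf{n},\mathbf{n}',\mathbf{n}'')/\|\mathbf{n}'\|^3$. *)

(* Defs.v *)
From Stdlib Require Import Reals.
From Coquelicot Require Import Coquelicot.
Open Scope R_scope.

(* Functions on an interval are total functions R -> R of which only the values
   on the interval matter: every hypothesis and conclusion is restricted to it. *)
Definition is_open_interval (J : R -> Prop) : Prop :=
  exists a b : Rbar, Rbar_lt a b /\
    forall s : R, J s <-> (Rbar_lt a s /\ Rbar_lt s b).

Definition smooth_on (J : R -> Prop) (f : R -> R) : Prop :=
  forall (k : nat) (s : R), J s -> ex_derive_n f k s.

Definition antiderivative_on (J : R -> Prop) (f F : R -> R) : Prop :=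
  forall s : R, J s -> is_derive F s (f s).

(* G is an antiderivative of vphi (cos phi)' satisfying the inequality that
   defines the class D_vphi. *)
Definition admissible_antiderivative
    (vphi : R -> R) (J : R -> Prop) (phi G : R -> R) : Prop :=
  antiderivative_on J
    (fun s => vphi s * Derive (fun u => cos (phi u)) s) G /\
  forall s : R, J s -> 1 > cos (phi s) ^ 2 + G s ^ 2.

Definition in_D (I : R -> Prop) (vphi : R -> R)
    (J : R -> Prop) (phi : R -> R) : Prop :=
  is_open_interval J /\
  (forall s : R, J s -> I s) /\
  smooth_on J phi /\
  (exists G : R -> R, admissible_antiderivative vphi J phi G) /\
  (forall s : R, J s -> Derive (fun u => cos (phi u)) s < 0).

Definition R3 : Type := (R * R * R)%type.

Definition dot (u v : R3) : R :=
  let '(u1, u2, u3) := u in let '(v1, v2, v3) := v in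
  u1 * v1 + u2 * v2 + u3 * v3.

Definition cross (u v : R3) : R3 :=
  let '(u1, u2, u3) := u in let '(v1, v2, v3) := v in
  (u2 * v3 - u3 * v2, u3 * v1 - u1 * v3, u1 * v2 - u2 * v1).

Definition det3 (u v w : R3) : R := dot (cross u v) w.

Definition enorm (u : R3) : R := sqrt (dot u u).

(* Derivative of a curve in the product normed module R * R * R. *)
Definition is_derive3 (c : R -> R3) (s : R) (v : R3) : Prop :=
  @is_derive R_AbsRing
    (prod_NormedModule R_AbsRing
       (prod_NormedModule R_AbsRing R_NormedModule R_NormedModule)
       R_NormedModule) c s v.

Definition scal3 (a : R) (u : R3) : R3 :=
  let '(u1, u2, u3) := u in (a * u1, a * u2, a * u3).

Definition plus3 (u v : R3) : R3 :=
  let '(u1, u2, u3) := u in let '(v1, v2, v3) := v in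
  (u1 + v1, u2 + v2, u3 + v3).

(* theta and the three coordinates are arbitrary antiderivatives; F is the
   prescribed antiderivative of vphi phi' sin phi. *)
Definition intrinsic_representation
    (J : R -> Prop) (phi F : R -> R) (rho : R -> R3) : Prop :=
  exists theta X Y Z : R -> R,
    antiderivative_on J
      (fun s => Derive phi s * / sin (phi s) * F s
                / sqrt (sin (phi s) ^ 2 - F s ^ 2)) theta /\
    antiderivative_on J (fun s => sin (phi s) * cos (theta s)) X /\
    antiderivative_on J (fun s => sin (phi s) * sin (theta s)) Y /\
    antiderivative_on J (fun s => cos (phi s)) Z /\
    (forall s : R, J s -> rho s = (X s, Y s, Z s)).

(* Frenet apparatus of the unit-speed curve c on J; c determines it on J. *)
Definition is_Frenet (J : R -> Prop) (c t n b : R -> R3)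
    (kappa tau : R -> R) : Prop :=
  forall s : R, J s ->
    is_derive3 c s (t s) /\
    enorm (t s) = 1 /\ enorm (n s) = 1 /\ dot (t s) (n s) = 0 /\
    b s = cross (t s) (n s) /\
    0 < kappa s /\
    is_derive3 t s (scal3 (kappa s) (n s)) /\
    is_derive3 n s
      (plus3 (scal3 (- kappa s) (t s)) (scal3 (tau s) (b s))) /\
    is_derive3 b s (scal3 (- tau s) (n s)).

(* sigma is the signed geodesic curvature at s of the (not necessarily
   unit-speed) curve c in the unit sphere; c1 and c2 are its derivatives. *)
Definition is_geodesic_curvature_S2 (c : R -> R3) (s sigma : R) : Prop :=
  exists (c1 : R -> R3) (c2 : R3),
    locally s (fun u => enorm (c u) = 1 /\ is_derive3 c u (c1 u)) /\
    is_derive3 c1 s c2 /\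
    enorm (c1 s) <> 0 /\
    sigma = det3 (c s) (c1 s) c2 / enorm (c1 s) ^ 3.

(* Main.v *)
Require Import Defs.
From Stdlib Require Import Reals Lra.
From Coquelicot Require Import Coquelicot.
Open Scope R_scope.

(** The tangent of the intrinsic representation curve is the unit vector [t]
with spherical coordinates [(phi, theta)].  Let [e1] and [e2] be the unit
vectors in the polar and azimuthal directions; they span the plane orthogonal
to [t], and moving the point of the sphere gives
[t' = phi' e1 + sin phi theta' e2].  The formula for [theta'] is chosen so that,
with [w = sqrt (sin^2 phi - F^2)], this equals
[kappa ((w / sin phi) e1 + (F / sin phi) e2)] where [kappa = phi' sin phi / w].
The bracket is a unit vector because [w^2 + F^2 = sin^2 phi], and [kappa] is
positive because [cos phi] decreases; so they are the normal and the curvature.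

Write [(w / sin phi, F / sin phi) = (cos alpha, sin alpha)].  The normal turns
in the plane [(e1, e2)] at the rate [alpha'], while the frame [(e1, e2)] itself
turns about [t] at the rate [cos phi theta'], so the torsion is
[alpha' + cos phi theta'].  Differentiating [F / sin phi] gives
[F' / w = vphi phi' sin phi / w] for this sum, that is [tau = vphi kappa].
This is carried by [Frenet_spherical] and [intrinsic_Frenet]; a curve has at most
one curvature and torsion ([Frenet_unique]), so any Frenet apparatus of it has
these two, and their quotient is [vphi].

The geodesic curvature of the normal comes from a formula valid for every curve
with differentiable [kappa] and [tau]: [n' = - kappa t + tau b] has norm
[sqrt (kappa^2 + tau^2)], and [det (n, n', n'') = kappa tau' - tau kappa']
([geodesic_curvature_normal]).  When [tau = vphi kappa] the determinant is
[kappa^2 vphi'] and the norm is [kappa sqrt (1 + vphi^2)]. *)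

(** * Differentiating curves in space *)

Definition crd1 (u : R3) : R := fst (fst u).
Definition crd2 (u : R3) : R := snd (fst u).
Definition crd3 (u : R3) : R := snd u.

Lemma R3_ext (u v : R3) :
  crd1 u = crd1 v -> crd2 u = crd2 v -> crd3 u = crd3 v -> u = v.
Proof.
  destruct u as [[u1 u2] u3], v as [[v1 v2] v3]; cbn.
  now intros -> -> ->.
Qed.

(** Pairing is a linear map of the product of the two target spaces, so the
chain rule applies to it. *)
Lemma is_derive_pair {U V : NormedModule R_AbsRing} (f : R -> U) (g : R -> V)
    (s : R) (df : U) (dg : V) :
  is_derive f s df -> is_derive g s dg ->
  @is_derive R_AbsRing (prod_NormedModule R_AbsRing U V)
    (fun u => (f u, g u)) s (df, dg).
Proof.
  intros Hf Hg.
  apply (filterdiff_ext_lin _ (fun y : R => (scal y df, scal y dg))).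
  - apply (filterdiff_comp'_2 (K := R_AbsRing) (T := R_NormedModule)
             (W := prod_NormedModule R_AbsRing U V) f g (fun x y => (x, y)) s
             (fun y : R => scal y df) (fun y : R => scal y dg) (fun x y => (x, y)) Hf Hg).
    apply filterdiff_linear, is_linear_prod.
    + apply is_linear_fst.
    + apply is_linear_snd.
  - reflexivity.
Qed.

Lemma is_derive_fst {U V : NormedModule R_AbsRing}
    (c : R -> prod_NormedModule R_AbsRing U V) (s : R) v :
  is_derive c s v -> is_derive (fun u => fst (c u)) s (fst v).
Proof.
  intros H.
  apply (filterdiff_ext_lin _ (fun y : R => fst (scal y v))).
  - apply (filterdiff_comp' (K := R_AbsRing) (U := R_NormedModule) c
             (fun p : prod_NormedModule R_AbsRing U V => fst p) s
             (fun y : R => scal y v) (fun p => fst p) H).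
    apply filterdiff_linear, is_linear_fst.
  - reflexivity.
Qed.

Lemma is_derive_snd {U V : NormedModule R_AbsRing}
    (c : R -> prod_NormedModule R_AbsRing U V) (s : R) v :
  is_derive c s v -> is_derive (fun u => snd (c u)) s (snd v).
Proof.
  intros H.
  apply (filterdiff_ext_lin _ (fun y : R => snd (scal y v))).
  - apply (filterdiff_comp' (K := R_AbsRing) (U := R_NormedModule) c
             (fun p : prod_NormedModule R_AbsRing U V => snd p) s
             (fun y : R => scal y v) (fun p => snd p) H).
    apply filterdiff_linear, is_linear_snd.
  - reflexivity.
Qed.

Lemma is_derive3_ext_loc (c d : R -> R3) (s : R) (v : R3) :
  locally s (fun u => c u = d u) -> is_derive3 c s v -> is_derive3 d s v.
Proof. apply is_derive_ext_loc. Qed.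

Lemma is_derive3_coords (c : R -> R3) (s : R) (v : R3) :
  is_derive3 c s v <->
  is_derive (fun u => crd1 (c u)) s (crd1 v) /\
  is_derive (fun u => crd2 (c u)) s (crd2 v) /\
  is_derive (fun u => crd3 (c u)) s (crd3 v).
Proof.
  split.
  - intros H; split; [| split].
    + exact (is_derive_fst _ _ _ (is_derive_fst _ _ _ H)).
    + exact (is_derive_snd _ _ _ (is_derive_fst _ _ _ H)).
    + exact (is_derive_snd _ _ _ H).
  - intros (H1 & H2 & H3).
    apply (is_derive3_ext_loc (fun u => (crd1 (c u), crd2 (c u), crd3 (c u)))).
    + apply filter_forall; intros u; now apply R3_ext.
    + replace v with (crd1 v, crd2 v, crd3 v) by now apply R3_ext.
      exact (is_derive_pair _ _ s _ _ (is_derive_pair _ _ s _ _ H1 H2) H3).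
Qed.

Lemma is_derive3_unique (c : R -> R3) (s : R) (u v : R3) :
  is_derive3 c s u -> is_derive3 c s v -> u = v.
Proof.
  rewrite !is_derive3_coords; intros (A1 & A2 & A3) (B1 & B2 & B3).
  apply R3_ext.
  - rewrite <- (is_derive_unique _ _ _ A1); now apply is_derive_unique.
  - rewrite <- (is_derive_unique _ _ _ A2); now apply is_derive_unique.
  - rewrite <- (is_derive_unique _ _ _ A3); now apply is_derive_unique.
Qed.

Lemma is_derive3_plus (c d : R -> R3) (s : R) (u v : R3) :
  is_derive3 c s u -> is_derive3 d s v ->
  is_derive3 (fun x => plus3 (c x) (d x)) s (plus3 u v).
Proof.
  intros Hc Hd.
  replace (plus3 u v) with (@plus (prod_AbelianMonoid
      (prod_AbelianMonoid R_AbelianMonoid R_AbelianMonoid) R_AbelianMonoid) u v)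
    by now destruct u as [[? ?] ?], v as [[? ?] ?].
  refine (is_derive3_ext_loc _ _ _ _ _ (is_derive_plus _ _ _ _ _ Hc Hd)).
  apply filter_forall; intros x.
  now destruct (c x) as [[? ?] ?], (d x) as [[? ?] ?].
Qed.

Lemma is_derive3_scal (k : R -> R) (c : R -> R3) (s dk : R) (v : R3) :
  is_derive k s dk -> is_derive3 c s v ->
  is_derive3 (fun x => scal3 (k x) (c x)) s
    (plus3 (scal3 dk (c s)) (scal3 (k s) v)).
Proof.
  rewrite !is_derive3_coords; intros Hk (H1 & H2 & H3).
  split; [| split].
  - apply (is_derive_ext (fun x => k x * crd1 (c x))).
    { intros x; now destruct (c x) as [[? ?] ?]. }
    replace (crd1 (plus3 (scal3 dk (c s)) (scal3 (k s) v)))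
      with (dk * crd1 (c s) + k s * crd1 v)
      by now destruct (c s) as [[? ?] ?], v as [[? ?] ?].
    apply (is_derive_mult k _ s dk _ Hk H1 Rmult_comm).
  - apply (is_derive_ext (fun x => k x * crd2 (c x))).
    { intros x; now destruct (c x) as [[? ?] ?]. }
    replace (crd2 (plus3 (scal3 dk (c s)) (scal3 (k s) v)))
      with (dk * crd2 (c s) + k s * crd2 v)
      by now destruct (c s) as [[? ?] ?], v as [[? ?] ?].
    apply (is_derive_mult k _ s dk _ Hk H2 Rmult_comm).
  - apply (is_derive_ext (fun x => k x * crd3 (c x))).
    { intros x; now destruct (c x) as [[? ?] ?]. }
    replace (crd3 (plus3 (scal3 dk (c s)) (scal3 (k s) v)))
      with (dk * crd3 (c s) + k s * crd3 v)
      by now destruct (c s) as [[? ?] ?], v as [[? ?] ?].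
    apply (is_derive_mult k _ s dk _ Hk H3 Rmult_comm).
Qed.

Lemma open_interval_locally (J : R -> Prop) (s : R) :
  is_open_interval J -> J s -> locally s J.
Proof.
  intros (a & b & _ & HJ) Hs.
  apply HJ in Hs.
  apply (filter_imp (fun u : R => Rbar_lt a u /\ Rbar_lt u b)).
  { intros u; apply HJ. }
  apply filter_and; [apply (open_Rbar_gt a s) | apply (open_Rbar_lt b s)]; apply Hs.
Qed.

(** * The Frenet apparatus *)

Lemma enorm_1 (u : R3) : enorm u = 1 <-> dot u u = 1.
Proof.
  unfold enorm; split; intros H.
  - rewrite <- (sqrt_sqrt (dot u u)), H; [ring |].
    destruct u as [[x y] z]; cbn; nra.
  - rewrite H; apply sqrt_1.
Qed.

Lemma unit_polar_unique (k k' : R) (u v : R3) :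
  0 < k -> 0 < k' -> enorm u = 1 -> enorm v = 1 ->
  scal3 k u = scal3 k' v -> k = k' /\ u = v.
Proof.
  rewrite !enorm_1.
  destruct u as [[u1 u2] u3], v as [[v1 v2] v3]; cbn.
  intros Hk Hk' Hu Hv E; injection E as E1 E2 E3.
  assert (Hkk : k = k').
  { apply Rsqr_inj; [lra | lra |]; unfold Rsqr.
    transitivity ((k * u1) * (k * u1) + (k * u2) * (k * u2) + (k * u3) * (k * u3)).
    - transitivity (k * k * (u1 * u1 + u2 * u2 + u3 * u3)); [rewrite Hu |]; ring.
    - rewrite E1, E2, E3.
      transitivity (k' * k' * (v1 * v1 + v2 * v2 + v3 * v3)); [| rewrite Hv]; ring. }
  subst k'; split; [reflexivity |].
  apply Rmult_eq_reg_l in E1, E2, E3; try lra.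
  now subst.
Qed.

(** The tangent is the derivative of the curve, [kappa n] that of the tangent,
and [- tau n] that of the binormal [t x n].  Openness of [J] makes each
pointwise identification hold near [s], so that it can be differentiated. *)
Lemma Frenet_unique (J : R -> Prop) (c t n b t' n' b' : R -> R3)
    (kappa tau kappa' tau' : R -> R) (hJ : is_open_interval J) :
  is_Frenet J c t n b kappa tau -> is_Frenet J c t' n' b' kappa' tau' ->
  forall s, J s -> kappa s = kappa' s /\ tau s = tau' s.
Proof.
  intros H H'.
  assert (Et : forall s, J s -> t s = t' s).
  { intros s Js.
    exact (is_derive3_unique c s _ _ (proj1 (H s Js)) (proj1 (H' s Js))). }
  assert (Ekn : forall s, J s -> kappa s = kappa' s /\ n s = n' s).
  { intros s Js.
    destruct (H s Js) as (_ & _ & n1 & _ & _ & k0 & dt & _).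
    destruct (H' s Js) as (_ & _ & n1' & _ & _ & k0' & dt' & _).
    apply unit_polar_unique; try assumption.
    apply (is_derive3_unique t' s); [| exact dt'].
    refine (is_derive3_ext_loc _ _ _ _ _ dt).
    exact (filter_imp _ _ Et (open_interval_locally J s hJ Js)). }
  intros s Js; split; [now apply Ekn |].
  destruct (H s Js) as (_ & _ & n1 & _ & _ & _ & _ & _ & db).
  destruct (H' s Js) as (_ & _ & _ & _ & _ & _ & _ & _ & db').
  assert (E : scal3 (- tau s) (n s) = scal3 (- tau' s) (n s)).
  { rewrite (proj2 (Ekn s Js)) at 2.
    apply (is_derive3_unique b' s); [| exact db'].
    refine (is_derive3_ext_loc _ _ _ _ _ db).
    apply (filter_imp J); [| now apply open_interval_locally].
    intros u Ju.
    destruct (H u Ju) as (_ & _ & _ & _ & -> & _).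
    destruct (H' u Ju) as (_ & _ & _ & _ & -> & _).
    now rewrite (Et u Ju), (proj2 (Ekn u Ju)). }
  apply enorm_1 in n1.
  destruct (n s) as [[x y] z]; cbn in n1, E.
  injection E as E1 E2 E3.
  (* Since n is a unit vector, tau is the inner product of tau n with n. *)
  transitivity (tau s * (x * x + y * y + z * z)); [rewrite n1; ring |].
  transitivity (tau' s * (x * x + y * y + z * z)); [| rewrite n1; ring].
  apply Ropp_eq_reg.
  transitivity ((- tau s * x) * x + (- tau s * y) * y + (- tau s * z) * z); [ring |].
  rewrite E1, E2, E3; ring.
Qed.

(** Lagrange's identity [|t x n|^2 = |t|^2 |n|^2 - (t . n)^2] supplies the norm
of the binormal. *)
Lemma enorm_Darboux_normal (t n : R3) (k w : R) :
  enorm t = 1 -> enorm n = 1 -> dot t n = 0 ->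
  enorm (plus3 (scal3 (- k) t) (scal3 w (cross t n))) = sqrt (k ^ 2 + w ^ 2).
Proof.
  rewrite !enorm_1; unfold enorm; intros Ht Hn Htn; f_equal.
  transitivity (k ^ 2 * dot t t + w ^ 2 * (dot t t * dot n n - dot t n ^ 2)).
  - destruct t as [[? ?] ?], n as [[? ?] ?]; cbn; ring.
  - rewrite Ht, Hn, Htn; ring.
Qed.

(** Differentiating [n' = - kappa t + tau b] by the Frenet equations gives
[n'' = - kappa' t + tau' b - (kappa^2 + tau^2) n], and the last term drops out
of [det (n, n', n'')].  Only the first derivatives of curvature and torsion
enter. *)
Lemma geodesic_curvature_normal (J : R -> Prop) (c t n b : R -> R3)
    (kappa tau : R -> R) (s dk dw : R) (hJ : is_open_interval J) (Js : J s) :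
  is_Frenet J c t n b kappa tau ->
  is_derive kappa s dk -> is_derive tau s dw ->
  is_geodesic_curvature_S2 n s
    ((kappa s * dw - tau s * dk) / sqrt (kappa s ^ 2 + tau s ^ 2) ^ 3).
Proof.
  intros H Hk Hw.
  destruct (H s Js) as (_ & t1 & n1 & tn & bs & k0 & dt & dn & db).
  pose proof (enorm_Darboux_normal _ _ (kappa s) (tau s) t1 n1 tn) as N.
  rewrite <- bs in N.
  exists (fun u => plus3 (scal3 (- kappa u) (t u)) (scal3 (tau u) (b u))).
  eexists; split; [| split; [| split]].
  - apply (filter_imp J); [| now apply open_interval_locally].
    intros u Ju; destruct (H u Ju) as (_ & _ & ? & _ & _ & _ & _ & ? & _); auto.
  - apply is_derive3_plus; apply is_derive3_scal; try eassumption.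
    apply (is_derive_opp kappa s dk Hk).
  - rewrite N; apply Rgt_not_eq, sqrt_lt_R0; nra.
  - rewrite N; f_equal.
    rewrite bs; apply enorm_1 in t1, n1.
    (* The second factor is the squared norm of t x n, hence 1; with it the
       identity holds for arbitrary vectors t and n. *)
    transitivity ((kappa s * dw - tau s * dk) *
                  (dot (t s) (t s) * dot (n s) (n s) - dot (t s) (n s) ^ 2)).
    + rewrite t1, n1, tn; ring.
    + change (opp dk) with (- dk).
      destruct (t s) as [[? ?] ?], (n s) as [[? ?] ?]; cbn; ring.
Qed.

(** * Curves with tangent in spherical coordinates *)

Definition radial (p q : R) : R3 := (sin p * cos q, sin p * sin q, cos p).
Definition polar (p q : R) : R3 := (cos p * cos q, cos p * sin q, - sin p).
Definition azimuthal (q : R) : R3 := (- sin q, cos q, 0).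

Lemma is_derive3_radial (p q : R -> R) (s dp dq : R) :
  is_derive p s dp -> is_derive q s dq ->
  is_derive3 (fun u => radial (p u) (q u)) s
    (plus3 (scal3 dp (polar (p s) (q s)))
           (scal3 (sin (p s) * dq) (azimuthal (q s)))).
Proof.
  intros Hp Hq; apply is_derive3_coords; cbn.
  assert (ex_derive p s) by now exists dp.
  assert (ex_derive q s) by now exists dq.
  assert (Ep : Derive (fun x : R => p x) s = dp) by now apply is_derive_unique.
  assert (Eq : Derive (fun x : R => q x) s = dq) by now apply is_derive_unique.
  split; [| split]; auto_derive; auto; cbn; rewrite ?Ep, ?Eq; ring.
Qed.

Lemma is_derive3_polar (p q : R -> R) (s dp dq : R) :
  is_derive p s dp -> is_derive q s dq ->
  is_derive3 (fun u => polar (p u) (q u)) s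
    (plus3 (scal3 (- dp) (radial (p s) (q s)))
           (scal3 (cos (p s) * dq) (azimuthal (q s)))).
Proof.
  intros Hp Hq; apply is_derive3_coords; cbn.
  assert (ex_derive p s) by now exists dp.
  assert (ex_derive q s) by now exists dq.
  assert (Ep : Derive (fun x : R => p x) s = dp) by now apply is_derive_unique.
  assert (Eq : Derive (fun x : R => q x) s = dq) by now apply is_derive_unique.
  split; [| split]; auto_derive; auto; cbn; rewrite ?Ep, ?Eq; ring.
Qed.

Lemma is_derive3_azimuthal (p q : R -> R) (s dq : R) :
  is_derive q s dq ->
  is_derive3 (fun u => azimuthal (q u)) s
    (plus3 (scal3 (- (sin (p s) * dq)) (radial (p s) (q s)))
           (scal3 (- (cos (p s) * dq)) (polar (p s) (q s)))).
Proof.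
  intros Hq; apply is_derive3_coords; cbn.
  assert (ex_derive q s) by now exists dq.
  pose proof (sin2_cos2 (p s)) as E; unfold Rsqr in E.
  assert (Eq : Derive (fun x : R => q x) s = dq) by now apply is_derive_unique.
  split; [| split]; auto_derive; auto; cbn; rewrite ?Eq.
  - transitivity (- (sin (p s) * sin (p s) + cos (p s) * cos (p s))
                  * dq * cos (q s)); [rewrite E |]; ring.
  - transitivity (- (sin (p s) * sin (p s) + cos (p s) * cos (p s))
                  * dq * sin (q s)); [rewrite E |]; ring.
  - ring.
Qed.

(** Here [a] and [f] are the cosine and sine of the angle [alpha] from the polar
direction to the normal.  The two conditions on their derivatives say
[alpha' = tau - cos p q']: the frame of the tangent plane of the sphere turns
about [t] at the rate [cos p q'], which has to be subtracted from the total
rate [tau] of the normal. *)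
Lemma Frenet_spherical (J : R -> Prop) (c : R -> R3)
    (p q a f dp dq kappa tau : R -> R) :
  (forall s, J s ->
     is_derive3 c s (radial (p s) (q s)) /\
     is_derive p s (dp s) /\ is_derive q s (dq s) /\
     0 < kappa s /\
     a s ^ 2 + f s ^ 2 = 1 /\
     dp s = kappa s * a s /\
     sin (p s) * dq s = kappa s * f s /\
     is_derive a s (- (tau s - cos (p s) * dq s) * f s) /\
     is_derive f s ((tau s - cos (p s) * dq s) * a s)) ->
  is_Frenet J c (fun s => radial (p s) (q s))
    (fun s => plus3 (scal3 (a s) (polar (p s) (q s)))
                    (scal3 (f s) (azimuthal (q s))))
    (fun s => plus3 (scal3 (- f s) (polar (p s) (q s)))
                    (scal3 (a s) (azimuthal (q s))))
    kappa tau.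
Proof.
  intros H s Js.
  destruct (H s Js) as (Hc & Hp & Hq & k0 & E & Edp & Edq & Ha & Hf).
  pose proof (sin2_cos2 (p s)) as Cp; pose proof (sin2_cos2 (q s)) as Cq.
  unfold Rsqr in Cp, Cq.
  pose proof (is_derive3_radial p q s _ _ Hp Hq) as Dr.
  pose proof (is_derive3_polar p q s _ _ Hp Hq) as Dp.
  pose proof (is_derive3_azimuthal p q s _ Hq) as Da.
  assert (Hf' : is_derive (fun u => - f u) s (- ((tau s - cos (p s) * dq s) * a s)))
    by apply (is_derive_opp f s _ Hf).
  pose proof (is_derive3_plus _ _ _ _ _
    (is_derive3_scal a _ s _ _ Ha Dp) (is_derive3_scal f _ s _ _ Hf Da)) as Dn.
  pose proof (is_derive3_plus _ _ _ _ _
    (is_derive3_scal _ _ s _ _ Hf' Dp) (is_derive3_scal a _ s _ _ Ha Da)) as Db.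
  assert (Eb : forall u, plus3 (scal3 (- f u) (polar (p u) (q u)))
                               (scal3 (a u) (azimuthal (q u)))
      = cross (radial (p u) (q u))
          (plus3 (scal3 (a u) (polar (p u) (q u)))
                 (scal3 (f u) (azimuthal (q u))))).
  { intros u.
    pose proof (sin2_cos2 (p u)) as Cpu; pose proof (sin2_cos2 (q u)) as Cqu.
    unfold Rsqr in Cpu, Cqu.
    apply R3_ext; cbn.
    - transitivity (- (f u * cos (p u) * cos (q u))
        - (sin (p u) * sin (p u) + cos (p u) * cos (p u)) * a u * sin (q u));
      [rewrite Cpu |]; ring.
    - transitivity (- (f u * cos (p u) * sin (q u))
        + (sin (p u) * sin (p u) + cos (p u) * cos (p u)) * a u * cos (q u));
      [rewrite Cpu |]; ring.
    - transitivity (f u * sin (p u)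
        * (sin (q u) * sin (q u) + cos (q u) * cos (q u)));
      [rewrite Cqu |]; ring. }
  refine (conj Hc (conj _ (conj _ (conj _ (conj (Eb s)
    (conj k0 (conj _ (conj _ _)))))))).
  - apply enorm_1; cbn.
    transitivity (sin (p s) * sin (p s)
      * (sin (q s) * sin (q s) + cos (q s) * cos (q s)) + cos (p s) * cos (p s));
    [ring | rewrite Cq, Rmult_1_r; exact Cp].
  - apply enorm_1; cbn.
    transitivity (a s ^ 2 * (cos (p s) * cos (p s)
      * (sin (q s) * sin (q s) + cos (q s) * cos (q s)) + sin (p s) * sin (p s))
      + f s ^ 2 * (sin (q s) * sin (q s) + cos (q s) * cos (q s))); [ring |].
    rewrite Cq.
    transitivity (a s ^ 2 * (sin (p s) * sin (p s) + cos (p s) * cos (p s)) + f s ^ 2);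
    [ring | rewrite Cp, Rmult_1_r; exact E].
  - cbn.
    transitivity (a s * sin (p s) * cos (p s)
      * ((sin (q s) * sin (q s) + cos (q s) * cos (q s)) - 1)); [ring |].
    rewrite Cq; ring.
  - replace (scal3 (kappa s) (plus3 (scal3 (a s) (polar (p s) (q s)))
                                    (scal3 (f s) (azimuthal (q s)))))
      with (plus3 (scal3 (dp s) (polar (p s) (q s)))
                  (scal3 (sin (p s) * dq s) (azimuthal (q s)))); [exact Dr |].
    rewrite Edp, Edq; apply R3_ext; cbn; ring.
  - revert Dn; match goal with |- is_derive3 _ _ ?u -> is_derive3 _ _ ?v =>
      replace v with u; [auto |] end.
    (* In this form kappa is visibly minus the t-component of n', and the identity
       becomes linear in the three vectors of the frame. *)
    assert (K : kappa s = a s * dp s + f s * (sin (p s) * dq s)).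
    { rewrite Edp, Edq.
      transitivity (kappa s * (a s ^ 2 + f s ^ 2)); [rewrite E |]; ring. }
    rewrite K.
    generalize (radial (p s) (q s)) (polar (p s) (q s)) (azimuthal (q s)).
    intros [[? ?] ?] [[? ?] ?] [[? ?] ?]; apply R3_ext; cbn; ring.
  - revert Db; match goal with |- is_derive3 _ _ ?u -> is_derive3 _ _ ?v =>
      replace v with u; [auto |] end.
    generalize (radial (p s) (q s)) (polar (p s) (q s)) (azimuthal (q s)).
    intros [[? ?] ?] [[? ?] ?] [[? ?] ?].
    rewrite Edp.
    apply R3_ext; cbn; ring [Edq].
Qed.

(** * The intrinsic representation *)

Section IntrinsicRepresentation.

Variables (J : R -> Prop) (vphi phi F : R -> R).

Let w (s : R) : R := sqrt (sin (phi s) ^ 2 - F s ^ 2).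

Definition intrinsic_curvature (s : R) : R := Derive phi s * sin (phi s) / w s.

Hypothesis hJ : is_open_interval J.
Hypothesis hphi : forall s, J s -> ex_derive phi s.
Hypothesis hF : antiderivative_on J (fun s => vphi s * (Derive phi s * sin (phi s))) F.
Hypothesis hw : forall s, J s -> F s ^ 2 < sin (phi s) ^ 2.
Hypothesis hdec : forall s, J s -> 0 < Derive phi s * sin (phi s).

Lemma w_pos (s : R) : J s -> 0 < w s.
Proof. intros Js; apply sqrt_lt_R0; specialize (hw s Js); lra. Qed.

Lemma w_sqr (s : R) : J s -> w s ^ 2 = sin (phi s) ^ 2 - F s ^ 2.
Proof. intros Js; apply pow2_sqrt; specialize (hw s Js); lra. Qed.

Lemma sin_phi_neq_0 (s : R) : J s -> sin (phi s) <> 0.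
Proof. intros Js E; specialize (hdec s Js); rewrite E in hdec; lra. Qed.

Lemma is_derive_sin_phi (s : R) : J s ->
  is_derive (fun u => sin (phi u)) s (Derive phi s * cos (phi s)).
Proof.
  intros Js; pose proof (hphi s Js).
  auto_derive; auto.
  change (Derive (fun x : R => phi x) s) with (Derive phi s); ring.
Qed.

Lemma is_derive_w (s : R) : J s ->
  is_derive w s
    ((sin (phi s) * cos (phi s) * Derive phi s
      - F s * (vphi s * (Derive phi s * sin (phi s)))) / w s).
Proof.
  intros Js.
  pose proof (w_pos s Js) as Hw.
  pose proof (is_derive_minus _ _ _ _ _
    (is_derive_pow _ 2 _ _ (is_derive_sin_phi s Js))
    (is_derive_pow _ 2 _ _ (hF s Js))) as D.
  assert (P : 0 < sin (phi s) ^ 2 - F s ^ 2) by (specialize (hw s Js); lra).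
  pose proof (is_derive_sqrt _ s _ D P) as D'.
  eapply is_derive_ext; [| eapply filterdiff_ext_lin; [exact D' |]].
  - reflexivity.
  - intros y; cbv beta; f_equal.
    change (sqrt (minus (sin (phi s) ^ 2) (F s ^ 2))) with (w s).
    unfold minus, plus, opp; cbn [pred INR AbelianMonoid.plus]; cbn.
    field; lra.
Qed.

(** The angle [alpha] has cosine [w / sin phi] and sine [F / sin phi], and
[alpha' + cos phi theta' = F' / w]. *)
Lemma intrinsic_Frenet (rho : R -> R3) :
  intrinsic_representation J phi F rho ->
  exists t n b,
    is_Frenet J rho t n b intrinsic_curvature (fun s => vphi s * intrinsic_curvature s).
Proof.
  intros (theta & X & Y & Z & Ht & HX & HY & HZ & Hrho).
  do 3 eexists.
  apply (Frenet_spherical J rho phi theta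
    (fun s => w s / sin (phi s)) (fun s => F s / sin (phi s))
    (Derive phi)
    (fun s => Derive phi s * / sin (phi s) * F s / w s)).
  intros s Js.
  pose proof (w_pos s Js) as Hw; pose proof (w_sqr s Js) as Ew.
  pose proof (sin_phi_neq_0 s Js) as HS.
  pose proof (is_derive_sin_phi s Js) as DS.
  split; [| split; [| split; [| split; [| split; [| split; [| split; [| split]]]]]]].
  - apply (is_derive3_ext_loc (fun u => (X u, Y u, Z u))).
    + apply (filter_imp J); [| now apply open_interval_locally].
      intros u Ju; now rewrite Hrho.
    + apply is_derive3_coords; cbn; auto.
  - now apply Derive_correct, hphi.
  - exact (Ht s Js).
  - apply Rdiv_lt_0_compat; auto.
  - transitivity ((w s ^ 2 + F s ^ 2) / sin (phi s) ^ 2); [field; auto |].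
    rewrite Ew; field; auto.
  - unfold intrinsic_curvature; field; split; auto; lra.
  - unfold intrinsic_curvature; field; split; auto; lra.
  - eapply filterdiff_ext_lin; [exact (is_derive_div _ _ s _ _ (is_derive_w s Js) DS HS) |].
    intros y; cbv beta; f_equal; unfold intrinsic_curvature.
    field_simplify_eq; [| split; auto; lra].
    ring [Ew].
  - eapply filterdiff_ext_lin; [exact (is_derive_div _ _ s _ _ (hF s Js) DS HS) |].
    intros y; cbv beta; f_equal; unfold intrinsic_curvature.
    field; split; auto; lra.
Qed.

Lemma ex_derive_intrinsic_curvature (s : R) :
  J s -> ex_derive (Derive phi) s -> ex_derive intrinsic_curvature s.
Proof.
  intros Js H2; apply ex_derive_div.
  - apply ex_derive_mult; [exact H2 |].
    eexists; now apply is_derive_sin_phi.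
  - eexists; now apply is_derive_w.
  - apply Rgt_not_eq, w_pos, Js.
Qed.

End IntrinsicRepresentation.

Lemma Rpower_three_halves (x : R) : 0 < x -> Rpower x (3 / 2) = sqrt x ^ 3.
Proof.
  intros Hx.
  rewrite <- (Rpower_sqrt x Hx), <- (Rpower_pow 3 (Rpower x (/ 2))), Rpower_mult.
  - f_equal; cbn; field.
  - apply exp_pos.
Qed.

Theorem theorem0p5 (I : R -> Prop) (vphi : R -> R)
    (hI : is_open_interval I) (hvphi : smooth_on I vphi)
    (J : R -> Prop) (phi : R -> R) (hphi : in_D I vphi J phi)
    (G : R -> R) (hG : admissible_antiderivative vphi J phi G)
    (rho : R -> R3)
    (hrho : intrinsic_representation J phi (fun s => - G s) rho) :
  let F := fun s => - G s in
  let w := fun s => sqrt (sin (phi s) ^ 2 - F s ^ 2) in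
  (exists (t n b : R -> R3) (kappa tau : R -> R),
      is_Frenet J rho t n b kappa tau) /\
  forall (t n b : R -> R3) (kappa tau : R -> R),
    is_Frenet J rho t n b kappa tau ->
    forall s : R, J s ->
      kappa s = Derive phi s * sin (phi s) / w s /\
      tau s = vphi s * Derive phi s * sin (phi s) / w s /\
      tau s / kappa s = vphi s /\
      is_geodesic_curvature_S2 n s
        (Derive vphi s * w s /
         (Rpower (1 + vphi s ^ 2) (3 / 2) * (Derive phi s * sin (phi s)))).
Proof.
  intros F w.
  destruct hphi as (hJ & hJI & smphi & _ & hdec).
  destruct hG as (HG & Hlt).
  assert (Dphi : forall s, J s -> ex_derive phi s)
    by (intros s Js; exact (smphi 1%nat s Js)).
  assert (Dcos : forall s, J s ->
    Derive (fun u => cos (phi u)) s = - (Derive phi s * sin (phi s))).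
  { intros s Js; apply is_derive_unique.
    pose proof (Dphi s Js); auto_derive; auto.
    change (Derive (fun x : R => phi x) s) with (Derive phi s); ring. }
  assert (HF : antiderivative_on J (fun s => vphi s * (Derive phi s * sin (phi s))) F).
  { intros s Js; pose proof (is_derive_opp G s _ (HG s Js)) as D.
    cbv beta in D; rewrite (Dcos s Js) in D.
    eapply filterdiff_ext_lin; [exact D |].
    intros y; cbv beta; f_equal; unfold opp; cbn; ring. }
  assert (Hw : forall s, J s -> F s ^ 2 < sin (phi s) ^ 2).
  { intros s Js; unfold F; pose proof (Hlt s Js).
    pose proof (sin2_cos2 (phi s)) as E; unfold Rsqr in E; nra. }
  assert (Hpos : forall s, J s -> 0 < Derive phi s * sin (phi s))
    by (intros s Js; pose proof (hdec s Js) as E; rewrite (Dcos s Js) in E; lra).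
  destruct (intrinsic_Frenet J vphi phi F hJ Dphi HF Hw Hpos rho hrho)
    as (t0 & n0 & b0 & H0).
  split; [now exists t0, n0, b0; do 2 eexists; exact H0 |].
  intros t n b kappa tau H.
  pose proof (Frenet_unique _ _ _ _ _ _ _ _ _ _ _ _ hJ H H0) as U.
  intros s Js.
  destruct (U s Js) as (Uk & Ut).
  assert (wp : 0 < w s) by exact (w_pos J phi F Hw s Js).
  pose proof (Hpos s Js) as pp.
  assert (Ek : intrinsic_curvature phi F s = Derive phi s * sin (phi s) / w s) by reflexivity.
  assert (k0 : 0 < intrinsic_curvature phi F s) by (rewrite Ek; now apply Rdiv_lt_0_compat).
  assert (Dk : ex_derive kappa s).
  { apply (ex_derive_ext_loc (intrinsic_curvature phi F)).
    - apply (filter_imp J); [| now apply open_interval_locally].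
      intros u Ju; symmetry; now apply U.
    - apply (ex_derive_intrinsic_curvature J vphi); auto.
      exact (smphi 2%nat s Js). }
  destruct Dk as [dk Dk].
  pose proof (Derive_correct _ _ (hvphi 1%nat s (hJI s Js)
    : ex_derive vphi s)) as Dv.
  assert (Dt : is_derive tau s (Derive vphi s * kappa s + vphi s * dk)).
  { apply (is_derive_ext_loc (fun u => vphi u * kappa u)).
    - apply (filter_imp J); [| now apply open_interval_locally].
      intros u Ju; destruct (U u Ju) as (-> & ->); reflexivity.
    - apply (is_derive_mult vphi kappa s _ _ Dv Dk Rmult_comm). }
  split; [| split; [| split]].
  - now rewrite Uk.
  - rewrite Ut, Ek; field; lra.
  - rewrite Uk, Ut; field; lra.
  - pose proof (geodesic_curvature_normal _ _ _ _ _ _ _ _ _ _ hJ Js H Dk Dt) as Hs.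
    revert Hs; match goal with
      |- is_geodesic_curvature_S2 _ _ ?x -> is_geodesic_curvature_S2 _ _ ?y =>
      replace y with x; [auto |] end.
    assert (v1 : 0 < 1 + vphi s ^ 2) by nra.
    rewrite Rpower_three_halves by exact v1.
    assert (Es : sqrt (kappa s ^ 2 + tau s ^ 2) = kappa s * sqrt (1 + vphi s ^ 2)).
    { rewrite Uk, Ut.
      replace (intrinsic_curvature phi F s ^ 2 + (vphi s * intrinsic_curvature phi F s) ^ 2)
        with (intrinsic_curvature phi F s ^ 2 * (1 + vphi s ^ 2)) by ring.
      rewrite sqrt_mult by (apply pow2_ge_0 || lra).
      rewrite sqrt_pow2 by lra; reflexivity. }
    pose proof (sqrt_lt_R0 _ v1) as s1.
    rewrite Es, Ut, Uk, Ek.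
    field.
    repeat split; lra || (intros Z; rewrite Z in pp; lra).
Qed.
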